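(* Let $k,r,d$ be non-negative integers with $r>d$. Then, as formal power series in $x$, $$\sum_{n\ge 0}{n+r\brace k+r}_{r,d}\,\frac{x^n}{n!} = \frac{1}{k!}\,(e^x-1)^k\, e^{(r-d)x}.$$
   Context: For non-negative integers $n,k,r,d$ with $n\ge r$, ${n\brace k}_{r,d}$ (the $(r,d)$-Stirling number of the second kind) denotes the number of partitions of $\{1,\dots,n\}$ into $k$ non-empty subsets such that the elements $1,\dots,r$ lie in pairwise different subsets and any two distinct elements $i,j$ in the same subset satisfy $|i-j|>d$. *)

(* Defs.v *)
From mathcomp Require Import all_boot all_order all_algebra.

Set Implicit Arguments.
Unset Strict Implicit.
Unset Printing Implicit Defensive.

Import Order.TTheory GRing.Theory Num.Theory.

(* The ground set {1, ..., n} is encoded as 'I_n = {0, ..., n-1} by i |-> i - 1;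
   differences are unchanged (`|i - j| is the absolute value of the difference
   in int, not a truncated subtraction), and {1, ..., r} becomes the set of i with i < r. *)
Definition rd_partition (n r d : nat) (P : {set {set 'I_n}}) : bool :=
  [&& partition P [set: 'I_n],
      [forall i : 'I_n, forall j : 'I_n,
         [&& i < r, j < r & i != j] ==> (pblock P i != pblock P j)]
    & [forall B in P, forall i in B, forall j in B,
         (i != j) ==> (d < `|i - j|)]].

Definition rd_stirling2 (n k r d : nat) : nat :=
  #|[set P : {set {set 'I_n}} | rd_partition r d P & #|P| == k]|.

Local Open Scope ring_scope.

(* A formal power series over the rationals is its sequence of coefficients;
   equality of series is the extensional equality =1. *)
Definition fps := nat -> rat.

Definition fps_one : fps := fun n => (n == 0)%:R.

Definition fps_sub (f g : fps) : fps := fun n => f n - g n.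

Definition fps_scale (c : rat) (f : fps) : fps := fun n => c * f n.

Definition fps_mul (f g : fps) : fps :=
  fun n => \sum_(i < n.+1) f i * g (n - i)%N.

Definition fps_pow (f : fps) (k : nat) : fps := iter k (fps_mul f) fps_one.

(* The series e^(c x). *)
Definition fps_expX (c : rat) : fps := fun n => c ^+ n / n`!%:R.

(* The exponential generating series of a. *)
Definition fps_egf (a : nat -> nat) : fps := fun n => (a n)%:R / n`!%:R.

(* Main.v *)
Require Import Defs.
From mathcomp Require Import all_boot all_order all_algebra.
From mathcomp Require Import zify ring.

Set Implicit Arguments.
Unset Strict Implicit.
Unset Printing Implicit Defensive.

Import Order.TTheory GRing.Theory Num.Theory.

(** Both conditions on a partition say that certain pairs of elements must not
    share a block: distinct elements below r, and distinct elements at distance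
    at most d.  So the partitions counted are the partitions of the vertices of
    a graph into independent sets (stable partitions).

    Suppose that a vertex x is added to a graph on D and that its neighbours in
    D form a clique of size c.  In a stable partition of D these neighbours
    occupy exactly c blocks, so x either forms a new block or joins one of the
    blocks that contain no neighbour; hence
      S(x + D, k + 1) = S(D, k) + (k + 1 - c) S(D, k + 1)
    (card_stable_partitionsU1).  Add the elements 0, 1, 2, ... one by one.  An
    element m < r is adjacent to all its predecessors, a clique of size m; an
    element m >= r > d is adjacent precisely to the d elements before it, which
    again form a clique, having pairwise distances below d.  The first r steps
    leave a single partition, into singletons; after that the recurrence has
    the constant c = d, and with k + r blocks it becomes
      a(n + 1, k) = a(n, k - 1) + (k + r - d) a(n, k)
    (rd_stirling2E).  The numbers therefore depend on r and d through r - d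
    only.

    On the analytic side let F_k = (e^x - 1)^k e^(c x) / k! with c = r - d.  As
    the derivative of e^x - 1 is (e^x - 1) + 1, one gets
      F_k' = (k + c) F_k + F_(k-1),
    which is the same recurrence on coefficients, with the same initial values
    F_k(0) = [k = 0] (egf_shifted_rstirling2). *)

(** * Partitions of a graph into independent sets *)

Section StablePartitions.

Variables (T : finType) (e : rel T).
Hypotheses (e_sym : symmetric e) (e_irr : irreflexive e).
Implicit Types (P Q : {set {set T}}) (B D K : {set T}) (x : T) (k : nat).

Definition stable P : bool :=
  [forall B in P, forall i in B, forall j in B, ~~ e i j].

Definition stable_partitions D k : {set {set {set T}}} :=
  [set P | [&& partition P D, stable P & #|P| == k]].

Lemma stableP P :
  reflect (forall B i j, B \in P -> i \in B -> j \in B -> ~~ e i j) (stable P).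
Proof.
apply: (iffP idP) => [/forall_inP sP B i j BP iB jB | sP].
  by have /forall_inP/(_ i iB)/forall_inP := sP B BP; apply.
apply/forall_inP => B BP; apply/forall_inP => i iB; apply/forall_inP => j jB.
exact: sP BP iB jB.
Qed.

Lemma setD1_notin (S : finType) (A : {set S}) a : a \notin A -> A :\ a = A.
Proof. by move=> aA; apply/setDidPl; rewrite disjoint_sym disjoints1. Qed.

(** The block B = set0 stands for the choice of a new block: then P loses
    nothing and [set x] is added, so that the two ways of placing x are treated
    by the same formula. *)
Definition insert_point x (p : {set {set T}} * {set T}) : {set {set T}} :=
  (x |: p.2) |: (p.1 :\ p.2).

(** The second component remembers where x was; it is set0 when x was alone,
    and then no block is put back. *)
Definition delete_point x Q : {set {set T}} * {set T} :=
  let B := pblock Q x :\ x in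
  let P := Q :\ pblock Q x in
  (if B == set0 then P else B |: P, B).

(** Blocks of P lie in D, which does not contain x; this makes the union in
    insert_point disjoint. *)
Lemma insert_point_fresh x P D B :
  partition P D -> x \notin D -> x |: B \notin P :\ B.
Proof.
move=> pP xD; apply: contra xD => /setD1P[_ BP].
by apply: (subsetP (partitionS pP BP)); rewrite setU11.
Qed.

Lemma partition_insert_point x P D B :
  partition P D -> x \notin D -> B \in set0 |: P ->
  partition (insert_point x (P, B)) (x |: D).
Proof.
move=> pP xD BP.
have BD : B \subset D.
  by case/setU1P: BP => [->|/(partitionS pP)//]; rewrite sub0set.
have pPB : partition (P :\ B) (D :\: B).
  case/setU1P: BP => [->|/(partitionD1 pP)//].
  by rewrite setD0 setD1_notin ?(partition0 pP).
have -> : x |: D = (x |: B) :|: (D :\: B).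
  by rewrite setDE -setUA setUIr setUCr setIT (setUidPr BD).
apply: partitionU1 pPB _ _; first by apply/set0Pn; exists x; rewrite setU11.
rewrite disjoints_subset subUset sub1set !inE (negPf xD) andbF /=.
by apply/subsetP => y yB; rewrite !inE yB.
Qed.

Lemma insert_pointK x P D B :
  partition P D -> x \notin D -> B \in set0 |: P ->
  delete_point x (insert_point x (P, B)) = (P, B).
Proof.
move=> pP xD BP; have pQ := partition_insert_point pP xD BP.
have fresh := insert_point_fresh B pP xD.
have xB : x \notin B.
  apply: contra xD; case/setU1P: BP => [->|BP]; first by rewrite inE.
  exact: (subsetP (partitionS pP BP)).
have pb : pblock (insert_point x (P, B)) x = x |: B.
  by apply: def_pblock (partition_trivIset pQ) _ _; rewrite setU11.
rewrite /delete_point pb /insert_point /= !setU1K //.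
case/setU1P: BP => [->|BP]; first by rewrite eqxx setD1_notin ?(partition0 pP).
by rewrite (negPf (partition_neq0 pP BP)) setD1K.
Qed.

Lemma delete_pointK x Q D :
  partition Q D -> x \in D -> insert_point x (delete_point x Q) = Q.
Proof.
move=> pQ xD; have xQ : x \in cover Q by rewrite (cover_partition pQ).
rewrite /insert_point /delete_point /= setD1K ?mem_pblock //.
(* Removing the shortened block restores the untouched blocks of Q, as it is
   either empty or was just added: it cannot be another block of Q, being
   nonempty and included in the block of x. *)
suff -> : (if pblock Q x :\ x == set0 then Q :\ pblock Q x
     else pblock Q x :\ x |: Q :\ pblock Q x) :\ (pblock Q x :\ x)
    = Q :\ pblock Q x.
  by rewrite setD1K ?pblock_mem.
case: eqP => [->|/eqP nz].
  by rewrite setD1_notin // inE (partition0 pQ) andbF.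
rewrite setU1K //; apply/negP => /setD1P[neq BQ].
have /trivIsetP/(_ _ _ BQ (pblock_mem xQ) neq) := partition_trivIset pQ.
by case/set0Pn: nz => y yB /disjointFr/(_ yB); case/setD1P: yB => _ ->.
Qed.

Lemma partition_delete_point x Q D :
  partition Q (x |: D) -> x \notin D ->
  partition (delete_point x Q).1 D.
Proof.
move=> pQ xD; have xQ : x \in cover Q by rewrite (cover_partition pQ) setU11.
have AQ := pblock_mem xQ; have pQA := partitionD1 pQ AQ.
have xA : x \in pblock Q x by rewrite mem_pblock.
have sAD := partitionS pQ AQ.
have DA : (pblock Q x :\ x) :|: ((x |: D) :\: pblock Q x) = D.
  apply/setP => y; rewrite !inE; case: (eqVneq y x) => [->|neq] /=.
    by rewrite xA (negPf xD).
  case: (boolP (y \in pblock Q x)) => //= yA.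
  by have := subsetP sAD y yA; rewrite !inE (negPf neq).
rewrite /delete_point /=; case: eqP => [B0|/eqP nz].
  by rewrite B0 set0U in DA; rewrite -[X in partition _ X]DA.
rewrite -[X in partition _ X]DA; apply: partitionU1 => //.
rewrite disjoints_subset; apply/subsetP => y /setD1P[_ yA].
by rewrite !inE yA.
Qed.

Lemma card_insert_point x P D B :
  partition P D -> x \notin D -> #|insert_point x (P, B)| = #|P :\ B|.+1.
Proof.
by move=> pP xD; rewrite /insert_point cardsU1 /= (insert_point_fresh B pP xD).
Qed.

Definition nbrs x D : {set T} := [set j in D | e x j].

Lemma stable_insert_point x P B :
  (B \in set0 |: P) ->
  stable (insert_point x (P, B)) =
  [&& stable P & [forall j in B, ~~ e x j]].
Proof.
move=> BP; apply/stableP/andP => [sQ | [/stableP sP /forall_inP fB] C i j].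
  split; last first.
    apply/forall_inP => j jB; apply: (sQ (x |: B)).
    - exact: setU11.
    - exact: setU11.
    - by rewrite !inE jB orbT.
  apply/stableP => C i j CP iC jC; have [eCB|neq] := eqVneq C B.
    by apply: (sQ (x |: B)); rewrite ?setU11 // !inE -eCB ?iC ?jC orbT.
  by apply: (sQ C) => //; rewrite !inE neq CP orbT.
case/setU1P => [-> | /setD1P[_ CP]]; last exact: sP.
have sB i' j' : i' \in B -> j' \in B -> ~~ e i' j'.
  by case/setU1P: BP => [->|BP]; [rewrite inE | exact: sP].
case/setU1P => [->|iB]; case/setU1P => [->|jB].
- by rewrite e_irr.
- exact: fB.
- by rewrite e_sym fB.
- exact: sB.
Qed.

(** In a stable partition two adjacent vertices lie in different blocks, so
    pblock is injective on a clique; the neighbours of x thus forbid as many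
    blocks as there are neighbours. *)
Lemma card_free_blocks x P D :
  partition P D -> stable P ->
  {in nbrs x D &, forall i j, i != j -> e i j} ->
  #|[set B in P | [forall j in B, ~~ e x j]]| = #|P| - #|nbrs x D|.
Proof.
move=> pP /stableP sP clique.
have tP := partition_trivIset pP; have cP := cover_partition pP.
have sub : pblock P @: nbrs x D \subset P.
  apply/subsetP => _ /imsetP[j jK ->]; apply: pblock_mem.
  by rewrite cP; case/setIdP: jK.
have -> : [set B in P | [forall j in B, ~~ e x j]] = P :\: pblock P @: nbrs x D.
  apply/setP => B; rewrite !inE andbC; case: (boolP (B \in P)); last first.
    by rewrite !andbF.
  move=> BP; rewrite !andbT; apply/forall_inP/negP => [fB /imsetP[j] | nB j jB].
    case/setIdP => jD exj eB; have /fB : j \in B by rewrite eB mem_pblock cP.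
    by rewrite exj.
  apply/negP => exj; apply: nB; apply/imsetP; exists j.
    by rewrite inE exj andbT (subsetP (partitionS pP BP)).
  by rewrite (def_pblock tP BP jB).
rewrite cardsD (setIidPr sub) card_in_imset // => i j iK jK eq_ij.
apply/eqP; apply: contraT => /(clique i j iK jK).
have [iD jD] : i \in D /\ j \in D by case/setIdP: iK; case/setIdP: jK.
by apply/contraLR => _; apply: (sP (pblock P i));
  rewrite ?pblock_mem ?mem_pblock ?cP // eq_ij mem_pblock cP.
Qed.

(** Deleting x maps the stable partitions of x |: D bijectively to pairs (P, B),
    where P is a stable partition of D and B is set0 or a block of P without
    neighbours of x.  The pairs with B = set0 give the first term and the others,
    for which P has one more block, give the second one.  The truncated
    subtraction is harmless: a stable partition of D has at least as many blocks
    as the clique has elements. *)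
Lemma card_stable_partitionsU1 x D k :
  x \notin D ->
  {in nbrs x D &, forall i j, i != j -> e i j} ->
  #|stable_partitions (x |: D) k.+1| =
    #|stable_partitions D k| +
      (k.+1 - #|nbrs x D|) * #|stable_partitions D k.+1|.
Proof.
move=> xD clique.
pose X : {set {set {set T}} * {set T}} :=
  [set p | [&& partition p.1 D, stable p.1, p.2 \in set0 |: p.1,
               [forall j in p.2, ~~ e x j] & #|p.1 :\ p.2| == k]].
have eX : stable_partitions (x |: D) k.+1 = insert_point x @: X.
  apply/setP => Q; apply/idP/imsetP => [|[[P B]]].
    rewrite inE => /and3P[pQ sQ cQ].
    have xxD : x \in x |: D by rewrite setU11.
    have pP := partition_delete_point pQ xD.
    have QK := delete_pointK pQ xxD; exists (delete_point x Q) => //.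
    have BP : (delete_point x Q).2 \in set0 |: (delete_point x Q).1.
      rewrite /delete_point /=; case: eqP => [->|_]; rewrite ?setU11 //.
      by rewrite setUCA setU11.
    move: pP QK BP; case: (delete_point x Q) => P B /= pP QK BP.
    have /andP[sP fB] : stable P && [forall j in B, ~~ e x j].
      by rewrite -stable_insert_point // QK.
    by rewrite inE /= pP sP BP fB -eqSS -(card_insert_point B pP xD) QK.
  rewrite inE /= => /and5P[pP sP BP fB cP] ->; rewrite inE.
  rewrite (partition_insert_point pP xD BP) stable_insert_point // sP fB /=.
  by rewrite (card_insert_point B pP xD).
have injX : {in X &, injective (insert_point x)}.
  apply: (can_in_inj (g := delete_point x)) => -[P B].
  by rewrite inE /= => /and5P[pP _ BP _ _]; apply: insert_pointK pP xD BP.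
rewrite eX card_in_imset //.
(* Separate the pairs where x is alone from those where x joins a block. *)
rewrite -(cardsID [set p | p.2 == set0] X); congr (_ + _)%N.
  have -> : X :&: [set p | p.2 == set0]
          = [set (P, set0) | P in stable_partitions D k].
    apply/setP => -[P B]; rewrite !inE /=; apply/andP/imsetP => [[]|[P']].
      case/and5P=> pP sP _ _ cP /eqP B0; exists P; last by rewrite B0.
      by move: cP; rewrite B0 setD1_notin ?(partition0 pP) // inE pP sP.
    rewrite inE => /and3P[pP sP cP] [-> ->]; rewrite pP sP eqxx /=.
    rewrite setD1_notin ?(partition0 pP) // cP andbT; split=> //.
    by apply/forall_inP => j; rewrite inE.
  by rewrite card_imset // => P P' [].
transitivity (\sum_(P in stable_partitions D k.+1)
    \sum_(B in [set B in P | [forall j in B, ~~ e x j]]) 1)%N.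
  rewrite pair_big_dep /= -sum1_card; apply: eq_bigl => -[P B].
  rewrite !inE /=; case pP: (partition P D); last by rewrite !andbF.
  case: (eqVneq B set0) => [->|B0] /=; first by rewrite (partition0 pP) !andbF.
  case: (boolP (B \in P)) => [BP|]; last by rewrite !andbF.
  rewrite (cardsD1 B P) BP add1n eqSS /=.
  by case: (stable P); case: (#|P :\ B| == k); rewrite ?andbT ?andbF.
rewrite [RHS]mulnC -sum_nat_const; apply: eq_bigr => P.
by rewrite inE => /and3P[pP sP /eqP <-]; rewrite sum1_card (card_free_blocks pP).
Qed.

End StablePartitions.

(** * The conflict graph of (r,d)-partitions *)

(** The r-Stirling number of n + c and k + c with parameter c: the number of
    partitions of n + c elements into k + c blocks that separate the first c
    elements. *)
Fixpoint shifted_rstirling2 (c n k : nat) : nat :=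
  match n, k with
  | 0, _ => k == 0
  | n'.+1, 0 => c * shifted_rstirling2 c n' 0
  | n'.+1, k'.+1 => shifted_rstirling2 c n' k' + (k + c) * shifted_rstirling2 c n' k
  end.

Lemma card_stable_partitions0 (T : finType) (e : rel T) (D : {set T}) :
  D != set0 -> #|stable_partitions e D 0| = 0.
Proof.
move=> D0; apply/eqP; rewrite cards_eq0 -subset0; apply/subsetP => P.
rewrite inE cards_eq0 => /and3P[pP _ /eqP P0].
by rewrite -(cover_partition pP) P0 /cover big_set0 eqxx in D0.
Qed.

Section Conflict.

Variables (N r d : nat).

Definition conflict : rel 'I_N :=
  fun i j => (i != j) && ((i < r) && (j < r) || (absz (i%:Z - j%:Z)%R <= d)).

Lemma conflict_sym : symmetric conflict.
Proof. by move=> i j; rewrite /conflict eq_sym distnC (andbC (i < r)). Qed.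

Lemma conflict_irr : irreflexive conflict.
Proof. by move=> i; rewrite /conflict eqxx. Qed.

Lemma rd_partitionE P :
  rd_partition r d P = partition P [set: 'I_N] && stable conflict P.
Proof.
rewrite /rd_partition; case pP: (partition P setT) => //=.
have tP := partition_trivIset pP; have cP := cover_partition pP.
have inP i : pblock P i \in P by rewrite pblock_mem // cP inE.
have in_pb i : i \in pblock P i by rewrite mem_pblock cP inE.
apply/andP/stableP => [[/forallP hr /forall_inP hd] B i j BP iB jB | sP].
  apply/negP => /andP[neq /orP[/andP[ir jr]|le_d]].
    have /forallP/(_ j) := hr i; rewrite ir jr neq /=.
    by rewrite (def_pblock tP BP iB) (def_pblock tP BP jB) eqxx.
  have /forall_inP/(_ i iB)/forall_inP/(_ j jB) := hd B BP.
  by rewrite neq ltnNge le_d.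
split.
  apply/forallP => i; apply/forallP => j; apply/implyP => /and3P[ir jr neq].
  apply/eqP => eq_ij; have := sP (pblock P i) i j (inP i) (in_pb i).
  by rewrite {1}eq_ij in_pb /conflict neq ir jr => /(_ isT).
apply/forall_inP => B BP; apply/forall_inP => i iB; apply/forall_inP => j jB.
apply/implyP => neq; rewrite ltnNge; apply: contra (sP B i j BP iB jB) => le_d.
by rewrite /conflict neq le_d orbT.
Qed.

Definition initial (m : nat) : {set 'I_N} := [set i : 'I_N | i < m].

Lemma card_interval a b : b <= N -> #|[set i : 'I_N | a <= i < b]| = b - a.
Proof.
elim: b => [_|b IHb bN].
  by apply/eqP; rewrite cards_eq0; apply/eqP/setP => i; rewrite !inE andbF.
have [ab|ba] := leqP a b; last first.
  by rewrite (eqP ba); apply/eqP; rewrite cards_eq0; apply/eqP/setP => i;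
     rewrite !inE; lia.
have -> : [set i : 'I_N | a <= i < b.+1] =
    Ordinal bN |: [set i : 'I_N | a <= i < b].
  by apply/setP => i; rewrite !inE -val_eqE /=; lia.
by rewrite cardsU1 inE /= ltnn andbF IHb ?subSn // ltnW.
Qed.

Hypothesis hrd : d < r.

(** For x >= r no predecessor of x is in conflict with x because of r, so only
    the d elements before x remain. *)
Lemma nbrs_initial (x : 'I_N) :
  nbrs conflict x (initial x) =
  [set i : 'I_N | (if x < r then 0 else x - d) <= i < x].
Proof.
apply/setP => i; rewrite !inE /conflict -val_eqE /=.
by case: ifP => xr; lia.
Qed.

(** For m >= r the d predecessors of m form a clique as their distances are
    below d; the hypothesis d < r ensures that there are d of them. *)
Lemma card_stable_initialS m k :
  m < N ->
  #|stable_partitions conflict (initial m.+1) k.+1| =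
    #|stable_partitions conflict (initial m) k| +
    (k.+1 - (if m < r then m else d)) *
      #|stable_partitions conflict (initial m) k.+1|.
Proof.
move=> mN; pose x := Ordinal mN.
have -> : initial m.+1 = x |: initial m.
  by apply/setP => i; rewrite !inE -val_eqE /= ltnS leq_eqVlt.
have nx := nbrs_initial x; rewrite /= in nx.
rewrite card_stable_partitionsU1 ?inE /= ?ltnn //.
- congr (_ + (_ - _) * _); rewrite nx card_interval; last exact: ltnW.
  by case: ifP => mr; lia.
- exact: conflict_sym.
- exact: conflict_irr.
move=> i j; rewrite nx !inE /conflict => hi hj ->.
by move: hi hj; case: ifP => mr; lia.
Qed.

(** The first r elements form a clique, whose only stable partition is the one
    into singletons. *)
Lemma card_stable_initial_clique m k :
  m <= r -> m <= N ->
  #|stable_partitions conflict (initial m) k| = (k == m).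
Proof.
elim: m k => [|m IHm] k mr mN.
  have -> : initial 0 = set0 by apply/setP => i; rewrite !inE.
  have -> : stable_partitions conflict set0 k = [set P | (P == set0) && (k == 0)].
    apply/setP => P; rewrite !inE partition_set0.
    case: eqP => //= ->; rewrite cards0 eq_sym.
    suff -> : stable conflict set0 by [].
    by apply/stableP => B i j; rewrite inE.
  case: (k == 0).
    by rewrite (_ : [set _ | _] = [set set0]) ?cards1 //; apply/setP => P;
       rewrite !inE andbT.
  by apply/eqP; rewrite cards_eq0; apply/eqP/setP => P; rewrite !inE andbF.
case: k => [|k].
  rewrite card_stable_partitions0 //; apply/set0Pn.
  by exists (Ordinal mN); rewrite inE.
rewrite card_stable_initialS // mr !IHm ?(ltnW mr) ?(ltnW mN) //.
by case: (eqVneq k.+1 m) => [<-|_]; rewrite ?subnn ?muln0 ?mul0n addn0 eqSS.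
Qed.

(** The first r elements already need r blocks.  This makes the term S(m, r - 1)
    of the recurrence vanish when k = 0 in card_stable_initial. *)
Lemma card_stable_initial_small m k :
  k < r -> r <= m -> m <= N ->
  #|stable_partitions conflict (initial m) k| = 0.
Proof.
move=> kr rm; rewrite -(subnK rm); move: (m - r) => {rm}n.
elim: n k kr => [|n IHn] [|k] kr nN.
- by rewrite add0n card_stable_initial_clique //; case: r kr.
- by rewrite add0n card_stable_initial_clique // ltn_eqF.
- apply: card_stable_partitions0; apply/set0Pn.
  by exists (Ordinal (leq_trans (ltn0Sn _) nN)); rewrite inE.
rewrite addSn card_stable_initialS // !IHn ?muln0 //; try exact: ltnW.
Qed.

Lemma card_stable_initial n k :
  n + r <= N ->
  #|stable_partitions conflict (initial (n + r)) (k + r)| =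
    shifted_rstirling2 (r - d) n k.
Proof.
elim: n k => [|n IHn] k nN.
  by rewrite card_stable_initial_clique // -[X in _ == X]add0n eqn_add2r.
have nN' : n + r <= N by apply: ltnW.
case: k => [|k] /=.
  have r0 : 0 < r by apply: leq_ltn_trans hrd.
  rewrite -[X in stable_partitions _ _ X](prednK r0) addSn card_stable_initialS //.
  rewrite card_stable_initial_small ?leq_addl //; last by rewrite prednK.
  rewrite prednK // -[X in stable_partitions _ _ X]add0n IHn //.
  by rewrite ltnNge leq_addl.
rewrite !addSn card_stable_initialS // IHn // -addSn IHn //.
by rewrite (ltnNge _ r) leq_addl /= addSn (addnBA _ (ltnW hrd)) subSn // ltnW // ltn_addl.
Qed.

End Conflict.

Lemma rd_stirling2E n k r d :
  d < r ->
  rd_stirling2 (n + r) (k + r) r d = shifted_rstirling2 (r - d) n k.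
Proof.
move=> hrd; rewrite -(card_stable_initial (N := n + r) hrd) //.
rewrite /rd_stirling2; congr #|pred_of_set _|; apply/setP => P.
rewrite !inE rd_partitionE andbA.
by have -> : initial (n + r) (n + r) = setT
  by apply/setP => i; rewrite !inE ltn_ord.
Qed.

Local Open Scope ring_scope.

(** * Generating functions *)

Definition fps_deriv (f : fps) : fps := fun n => n.+1%:R * f n.+1.

Lemma fps_derivM f g n :
  fps_deriv (fps_mul f g) n =
  fps_mul (fps_deriv f) g n + fps_mul f (fps_deriv g) n.
Proof.
rewrite /fps_deriv /fps_mul.
transitivity (\sum_(i < n.+2) (i%:R * f i * g (n.+1 - i)%N
    + f i * ((n.+1 - i)%:R * g (n.+1 - i)%N))).
  rewrite mulr_sumr; apply: eq_bigr => i _.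
  by rewrite natrB ?leq_ord //; ring.
rewrite big_split /= big_ord_recl !mul0r add0r; congr (_ + _).
rewrite big_ord_recr /= subnn mul0r mulr0 addr0.
by apply: eq_bigr => i _; rewrite subSn ?leq_ord.
Qed.

Lemma fps_deriv_expX c n : fps_deriv (fps_expX c) n = c * fps_expX c n.
Proof.
rewrite /fps_deriv /fps_expX exprS factS natrM.
have ? : n`!%:R != 0 :> rat by rewrite pnatr_eq0 -lt0n fact_gt0.
have ? : n.+1%:R != 0 :> rat by rewrite pnatr_eq0.
by field; rewrite nat1r; apply/andP.
Qed.

Local Notation expX1 := (fps_sub (fps_expX 1) fps_one).

Lemma fps_mul1 g : fps_mul fps_one g =1 g.
Proof.
move=> n; rewrite /fps_mul /fps_one big_ord_recl mul1r subn0 big1 ?addr0 //.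
by move=> i _; rewrite mul0r.
Qed.

(** Since (e^x - 1)' = 1 + (e^x - 1), differentiation acts on the powers of
    e^x - 1 without leaving their span.  For k = 0 the factor k kills the term
    with the truncated predecessor. *)
Lemma fps_deriv_pow_expX1 k n :
  fps_deriv (fps_pow expX1 k) n =
  k%:R * (fps_pow expX1 k n + fps_pow expX1 k.-1 n).
Proof.
elim: k n => [|k IHk] n; first by rewrite /fps_deriv mulr0 mul0r.
have dE m : fps_deriv expX1 m = fps_one m + expX1 m.
  rewrite {1}/fps_deriv /fps_sub -/(fps_deriv _ _) {2}/fps_one subr0.
  by rewrite -/(fps_deriv (fps_expX 1) m) fps_deriv_expX mul1r addrC subrK.
rewrite -[fps_pow expX1 k.+1]/(fps_mul expX1 (fps_pow expX1 k)) fps_derivM /=.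
have -> : fps_mul (fps_deriv expX1) (fps_pow expX1 k) n =
    fps_pow expX1 k n + fps_mul expX1 (fps_pow expX1 k) n.
  rewrite -(fps_mul1 (fps_pow expX1 k)) /fps_mul -big_split.
  by apply: eq_bigr => i _; rewrite dE mulrDl.
have -> : fps_mul expX1 (fps_deriv (fps_pow expX1 k)) n =
    k%:R * (fps_mul expX1 (fps_pow expX1 k) n + fps_pow expX1 k n).
  (* For k = 0 both sides vanish; otherwise the product of e^x - 1 with its
     power of exponent k - 1 is the k-th power by definition. *)
  have -> : k%:R * (fps_mul expX1 (fps_pow expX1 k) n + fps_pow expX1 k n) =
    k%:R * (fps_mul expX1 (fps_pow expX1 k) n
            + fps_mul expX1 (fps_pow expX1 k.-1) n).
    by case: (k) => [|j]; rewrite ?mul0r.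
  rewrite /fps_mul -big_split mulr_sumr; apply: eq_bigr => i _.
  by rewrite /= IHk; ring.
by rewrite -[k.+1]add1n natrD; ring.
Qed.

Definition pow_mul_exp c k : fps := fps_mul (fps_pow expX1 k) (fps_expX c).

Lemma fps_deriv_pow_mul_exp c k n :
  fps_deriv (pow_mul_exp c k) n =
  (k%:R + c) * pow_mul_exp c k n + k%:R * pow_mul_exp c k.-1 n.
Proof.
rewrite fps_derivM /pow_mul_exp /fps_mul !mulr_sumr -!big_split.
apply: eq_bigr => i _ /=; rewrite fps_deriv_pow_expX1 fps_deriv_expX; ring.
Qed.

Lemma pow_mul_exp0 c k : pow_mul_exp c k 0%N = (k == 0%N)%:R.
Proof.
have expX0 a : fps_expX a 0%N = 1 by rewrite /fps_expX expr0 fact0 divr1.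
rewrite /pow_mul_exp /fps_mul big_ord1 subnn expX0 mulr1.
by case: k => [//|k]; rewrite /= /fps_mul big_ord1 /fps_sub expX0 subrr mul0r.
Qed.

(** Multiplied by n + 1, the coefficient of index n + 1 of either side becomes
    the coefficient of index n of its derivative; there the differential
    equation of fps_deriv_pow_mul_exp matches the recurrence that defines the
    numbers. *)
Lemma egf_shifted_rstirling2 c k :
  fps_egf (fun n => shifted_rstirling2 c n k) =1
  fps_scale (k`!%:R)^-1 (pow_mul_exp c%:R k).
Proof.
move=> n; rewrite /fps_egf /fps_scale; elim: n k => [|n IHn] k.
  rewrite pow_mul_exp0 fact0 divr1 /=; case: eqP => [->|_]; last by rewrite mulr0.
  by rewrite fact0 invr1 mul1r.
have n1 : n.+1%:R != 0 :> rat by rewrite pnatr_eq0.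
have fn m : m`!%:R != 0 :> rat by rewrite pnatr_eq0 -lt0n fact_gt0.
apply: (mulfI n1); rewrite [RHS]mulrCA -/(fps_deriv _ n) fps_deriv_pow_mul_exp.
have -> a : n.+1%:R * (a / n.+1`!%:R) = a / n`!%:R :> rat.
  by rewrite factS natrM; field; rewrite nat1r n1 fn.
case: k => [|k] /=.
  by rewrite natrM -mulrA IHn mul0r addr0 add0r; ring.
rewrite natrD natrM mulrDl -mulrA !IHn natrD factS natrM.
have k1 : k.+1%:R != 0 :> rat by rewrite pnatr_eq0.
by field; rewrite nat1r k1 fn.
Qed.

Theorem theorem1p9 (k r d : nat) (hrd : (d < r)%N) :
  fps_egf (fun n : nat => rd_stirling2 (n + r) (k + r) r d) =1
  fps_scale (k`!%:R)^-1
    (fps_mul (fps_pow (fps_sub (fps_expX 1) fps_one) k)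
             (fps_expX (r%:R - d%:R))).
Proof.
move=> n; rewrite -natrB ?(ltnW hrd) // -/(pow_mul_exp _ k) -egf_shifted_rstirling2.
by rewrite /fps_egf rd_stirling2E.
Qed.
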